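(* Let $D,D_1,D_2$ be distortion functions with corresponding probability measures $Q,Q_1,Q_2$ on $\mathcal{B}((0,1))$. Then: (1) If $D_1\le D_2$, then $\mathcal{L}_{Q_1}\subseteq\mathcal{L}_{Q_2}$ and $\varrho_{Q_2}[X]\le\varrho_{Q_1}[X]$ holds for every $X\in\mathcal{L}_{Q_1}$. (2) If $D\le D^E$, then $\mathcal{L}_Q\subseteq\mathcal{L}_{Q^E}$ and $E[X]\le\varrho_Q[X]$ holds for every $X\in\mathcal{L}_Q$. (3) If $D$ is convex, then $\mathcal{L}_Q\subseteq\mathcal{L}_{Q^E}$ and $E[X]\le\varrho_Q[X]$ holds for every $X\in\mathcal{L}_Q$. (4) Let $\alpha,\beta\in[0,1)$. If $\alpha\le\beta$, then $\varrho_{Q^{\mathrm{ES}_\alpha}}[X]\le\varrho_{Q^{\mathrm{ES}_\beta}}[X]$ holds for every $X\in\mathcal{L}_{Q^E}$. (5) The identity $E[X]=\inf_{\alpha\in(0,1)}\varrho_{Q^{\mathrm{ES}_\alpha}}[X]$ holds for every $X\in\mathcal{L}_{Q^E}$.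
   Context: ''Increasing'' is meant in the weak sense. $(\Omega,\mathcal{F},P)$ is a fixed probability space and $\mathcal{L}^0$ is the set of all real random variables on it. $\lambda$ denotes Lebesgue measure on $\mathcal{B}((0,1))$. For $X\in\mathcal{L}^0$, $F_X(x):=P[\{X\le x\}]$ and $F_X^\leftarrow:(0,1)\to\mathbb{R}$, $F_X^\leftarrow(u):=\inf\{x\in\mathbb{R}\mid F_X(x)\ge u\}$, is the (lower) quantile function. A distortion function is an increasing, right-continuous function $D:[0,1]\to[0,1]$ with $D(0)=0$ and $\sup_{u\in(0,1)}D(u)=1$ (hence $D(1)=1$). The probability measure $Q$ on $\mathcal{B}((0,1))$ corresponding to $D$ is the unique one with $Q[(0,u]]=D(u)$ for all $u\in(0,1)$. For such $Q$, $\mathcal{L}_Q:=\{X\in\mathcal{L}^0\mid\int_{(0,1)}(F_X^\leftarrow(u))^+\,dQ(u)<\infty\}$, and the quantile risk measure $\varrho_Q:\mathcal{L}_Q\to[-\infty,\infty)$ is $\varrho_Q[X]:=\int_{(0,1)}F_X^\leftarrow(u)\,dQ(u)$. $D^E(u):=u$, with corresponding measure $Q^E=\lambda$; here $\mathcal{L}_{Q^E}=\{X\in\mathcal{L}^0\mid E[X^+]<\infty\}$ and $\varrho_{Q^E}[X]=E[X]\in[-\infty,\infty)$. For $\alpha\in[0,1)$, $D^{\mathrm{ES}_\alpha}(u):=\frac{u-\alpha}{1-\alpha}\chi_{[\alpha,1]}(u)$ with corresponding measure $Q^{\mathrm{ES}_\alpha}$, which has $\lambda$-density $\frac{1}{1-\alpha}\chi_{(\alpha,1)}$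 ($\chi_B$ is the indicator function of $B$); one has $\mathcal{L}_{Q^{\mathrm{ES}_\alpha}}=\mathcal{L}_{Q^E}$. *)

(* Defs.v *)
From HB Require Import structures.
From mathcomp Require Export all_boot all_order all_algebra.
From mathcomp Require Import lra.
From mathcomp Require Export all_classical all_reals all_analysis.
Export Order.TTheory GRing.Theory Num.Theory.
Export numFieldNormedType.Exports.

Set Implicit Arguments.
Unset Strict Implicit.
Unset Printing Implicit Defensive.

#[export] Set Implicit Arguments.
#[export] Unset Strict Implicit.
#[export] Unset Printing Implicit Defensive.

Local Open Scope classical_set_scope.
Local Open Scope ring_scope.

(* A function on [0, 1] is represented by a total function R -> R of which only
   the values on [0, 1] are constrained. *)
Record distortion (R : realType) (D : R -> R) : Prop := Distortion {
  distortion_itv : forall u, u \in `[0, 1] -> D u \in `[0, 1] ;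
  distortion_nd : {in `[0, 1] &, {homo D : u v / u <= v}} ;
  distortion_rc : forall u, u \in `[0, 1[ -> D x @[x --> u^'+] --> D u ;
  distortion0 : D 0 = 0 ;
  distortion_sup : sup [set D u | u in `]0, 1[] = 1 }.

Definition le01 (R : realType) (D1 D2 : R -> R) : Prop :=
  {in `[0, 1], forall u, D1 u <= D2 u}.

(* A measure on the Borel sets of (0, 1) is represented by a measure on the
   Borel sets of R which vanishes outside (0, 1). *)
Record corresponds (R : realType) (D : R -> R)
    (Q : {measure set (measurableTypeR R) -> \bar R}) : Prop := Corresponds {
  corresponds_out : Q (~` `]0, 1[%classic) = 0%E ;
  corresponds_mass : Q `]0, 1[%classic = 1%E ;
  corresponds_val : forall u, u \in `]0, 1[ -> Q `]0, u]%classic = (D u)%:E }.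

Section corresponds_exists.
Context (R : realType) (D : R -> R) (hD : distortion D).

Let D1 : D 1 = 1.
Proof.
have DS : ubound [set D u | u in `]0, 1[] 1.
  apply/ubP => _ [u + <-]; rewrite /= => u01.
  have /(distortion_itv hD) : u \in `[0, 1].
    by move: u01; rewrite !in_itv/= => /andP[/ltW -> /ltW ->].
  by rewrite in_itv/= => /andP[].
have /(distortion_itv hD) : (1 : R) \in `[0, 1] by rewrite in_itv/= ler01 lexx.
rewrite in_itv/= => /andP[_ D1]; apply/eqP; rewrite eq_le D1/=.
rewrite -[leLHS](distortion_sup hD); apply: ge_sup.
  by exists (D 2^-1), 2^-1 => //=; rewrite in_itv/=; lra.
apply/ubP => _ [u + <-]; rewrite /= in_itv/= => /andP[u0 u1].
by apply: (distortion_nd hD); rewrite ?in_itv/=; lra.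
Qed.

Let F (u : R) : R := D (Num.max 0 (Num.min u 1)).

Let F_nd : nondecreasing F.
Proof.
move=> u v uv; apply: (distortion_nd hD); rewrite ?in_itv/=.
- by rewrite le_max lexx/= ge_max ler01 ge_min lexx orbT.
- by rewrite le_max lexx/= ge_max ler01 ge_min lexx orbT.
- by rewrite ge_max !le_max lexx/= le_min !ge_min uv lexx !orbT.
Qed.

Let F_rc : right_continuous F.
Proof.
move=> u; have [u0|u0] := ltP u 0.
  rewrite {2}/F (_ : Num.max _ _ = 0); last by rewrite max_l// ge_min ltW.
  apply: cvg_near_cst; near=> x.
  by rewrite /F max_l// ge_min; apply/orP; left; near: x; exact: nbhs_right_le.
have [u1|u1] := ltP u 1.
  rewrite {2}/F min_l ?(ltW u1)// max_r//.
  apply: cvg_trans (distortion_rc hD (u := u) _); last by rewrite in_itv/= u0.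
  apply: near_eq_cvg; near=> x.
  rewrite /F min_l; last by near: x; exact: nbhs_right_le.
  by rewrite max_r// (le_trans u0).
rewrite {2}/F min_r// max_r// D1.
apply: cvg_near_cst; near=> x.
by rewrite /F min_r ?max_r// (le_trans u1).
Unshelve. all: by end_near. Qed.

#[local] HB.instance Definition _ := isCumulative.Build R _ R F F_nd F_rc.

Let F_Ny : F @ -oo --> (0 : R).
Proof.
apply: cvg_near_cst; near=> x.
rewrite /F max_l ?(distortion0 hD)// ge_min; apply/orP; left.
by near: x; exact: nbhs_ninfty_le.
Unshelve. all: by end_near. Qed.

Let F_y : F @ +oo --> (1 : R).
Proof.
apply: cvg_near_cst; near=> x.
rewrite /F min_r ?max_r//.
Unshelve. all: end_near. Qed.

#[local] HB.instance Definition _ := isCumulativeBounded.Build R 0 1 F F_Ny F_y.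

Lemma corresponds_exists :
  exists Q : probability (measurableTypeR R) R, corresponds D Q.
Proof.
pose Q : probability (measurableTypeR R) R := lebesgue_stieltjes_measure F.
have QF r : Q `]-oo, r]%classic = (F r)%:E.
  rewrite -(cdf_lebesgue_stieltjes_id F r)//.
clearbody Q.
have Q0u u : u \in `]0, 1[ -> Q `]0, u]%classic = (D u)%:E.
  rewrite in_itv/= => /andP[u0 u1].
  have : `]0, u]%classic = `]-oo, u] `\` `]-oo, (0:R)] => [|->].
    by rewrite -[RHS]setCK setCD setCitvl setUC -[LHS]setCK setCitv.
  have Qfin r : (Q `]-oo, r]%classic < +oo)%E by rewrite QF ltry.
  rewrite measureD//; last exact: Qfin.
  rewrite setIidr; last by apply: subset_itvl; rewrite bnd_simp ltW.
  rewrite [X in (X - _)%E](_ : _ = (F u)%:E); last exact: QF.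
  rewrite [X in (_ - X)%E](_ : _ = (F 0)%:E); last exact: QF.
  rewrite /F min_l ?(ltW u1)// max_r ?(ltW u0)// min_l// max_l//.
  by rewrite (distortion0 hD) sube0.
have Q01 : Q `]0, 1[%classic = 1%E.
  apply/eqP; rewrite eq_le probability_le1//=.
  have fQ A : measurable A -> Q A \is a fin_num by exact: fin_num_measure.
  rewrite -[leRHS]fineK ?fQ// lee_fin.
  rewrite -[leLHS](distortion_sup hD); apply: ge_sup.
    by exists (D 2^-1), 2^-1 => //=; rewrite in_itv/=; lra.
  apply/ubP => _ [u + <-]; rewrite /= => u01.
  rewrite -lee_fin fineK ?fQ// -Q0u//.
  apply: le_measure; rewrite ?inE//.
  by apply: subset_itvl; move: u01; rewrite in_itv/= bnd_simp => /andP[].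
exists Q; split => //.
rewrite -[LHS]/(Q (~` `]0, 1[%classic)) probability_setC// -[X in (1 - X)%E]/(Q `]0, 1[%classic).
by rewrite Q01 subee.
Qed.
End corresponds_exists.

Section quantile.
Context d (T : measurableType d) (R : realType) (P : probability T R).

Definition quantile (X : {RV P >-> R}) (u : R) : R :=
  inf [set x : R | (u%:E <= cdf X x)%E].

Variable Q : {measure set (measurableTypeR R) -> \bar R}.

Definition qdom : set {RV P >-> R} :=
  [set X | (\int[Q]_(u in `]0%R, 1%R[) (Num.max (quantile X u) 0)%:E < +oo)%E].

(* Only meaningful on [qdom], where the integral of the positive part is
   finite; the value may be -oo there. *)
Definition qrm (X : {RV P >-> R}) : \bar R :=
  (\int[Q]_(u in `]0%R, 1%R[) (quantile X u)%:E)%E.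

End quantile.
Arguments quantile {d T R P} X u.
Arguments qdom {d T R} P Q.
Arguments qrm {d T R P} Q X.

Definition DE (R : realType) (u : R) : R := u.

Lemma distortion_DE (R : realType) : distortion (@DE R).
Proof.
split=> //.
- by move=> u _; apply: cvg_at_right_filter; exact: cvg_id.
- rewrite /DE image_id; by apply: sup_itv; rewrite bnd_simp.
Qed.

Definition QE (R : realType) : {measure set (measurableTypeR R) -> \bar R} :=
  mrestr lebesgue_measure (measurable_itv `]0%R, 1%R[).
Arguments QE : clear implicits.

Definition DES (R : realType) (a u : R) : R :=
  (u - a) / (1 - a) * \1_(`[a, 1] : set R) u.

(* The measure with Lebesgue density (1 - a)^-1 on (a, 1), for 0 <= a < 1; the
   absolute value makes the factor nonnegative for every real [a]. *)
Definition QES (R : realType) (a : R) :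
    {measure set (measurableTypeR R) -> \bar R} :=
  mscale (`|1 - a|^-1)%:nng
    (mrestr lebesgue_measure (measurable_itv `]a, 1%R[)).


Lemma corresponds_QE (R : realType) : corresponds (@DE R) (QE R).
Proof.
split=> [||u]; rewrite /QE /= /mrestr.
- by rewrite setICl measure0.
- by rewrite setIid lebesgue_measure_itv/= lte_fin ltr01 sube0.
- rewrite in_itv/= => /andP[u0 u1]; rewrite setIidl.
    by rewrite lebesgue_measure_itv/= lte_fin u0 sube0.
  by move=> x /=; rewrite !in_itv/= => /andP[-> /le_lt_trans]; exact.
Qed.

Lemma distortion_DES (R : realType) (a : R) :
  a \in `[0, 1[ -> distortion (DES a).
Proof.
rewrite in_itv/= => /andP[a0 a1].
have a1' : 0 < 1 - a by rewrite subr_gt0.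
have DESE u : u <= 1 -> DES a u = Num.max (u - a) 0 / (1 - a).
  move=> u1; rewrite /DES indicE mem_setE in_itv/= u1 andbT.
  case: leP => au; first by rewrite max_l ?subr_ge0// mulr1.
  by rewrite max_r ?mul0r ?mulr0// subr_le0 ltW.
split.
- move=> u; rewrite !in_itv/= => /andP[u0 u1]; rewrite DESE//.
  rewrite divr_ge0 ?le_max ?lexx ?orbT ?(ltW a1')//=.
  by rewrite ler_pdivrMr// mul1r ge_max lerD2r u1 ltW.
- move=> u v; rewrite !in_itv/= => /andP[_ u1] /andP[_ v1] uv.
  rewrite !DESE// ler_pM2r ?invr_gt0//.
  by rewrite ge_max !le_max lerD2r uv lexx orbT.
- move=> u; rewrite in_itv/= => /andP[_ u1].
  rewrite (DESE _ (ltW u1)).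
  apply: (@cvg_trans _ ((Num.max (x - a) 0 / (1 - a)) @[x --> u^'+])).
    apply: near_eq_cvg; near=> x; rewrite DESE//.
    by near: x; exact: nbhs_right_le.
  apply: cvgMl; apply: cvg_at_right_filter.
  apply: (@continuous_comp _ _ _ (fun x => x - a) (Num.max^~ 0)).
    by apply: cvgB; [exact: cvg_id|exact: cvg_cst].
  apply: continuous_max; [exact: cvg_id|exact: cvg_cst].
- by rewrite DESE// max_r ?mul0r// sub0r oppr_le0.
- set S := [set _ | _ in _].
  have uS : ubound S 1.
    apply/ubP => _ [u + <-]; rewrite /= in_itv/= => /andP[u0 u1].
    rewrite (DESE _ (ltW u1)) ler_pdivrMr// mul1r ge_max lerD2r.
    by rewrite (ltW u1) ltW.
  have hS : has_ubound S by exists 1.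
  have S1 t : 0 < t -> t < 1 -> t <= sup S.
    move=> t0 t1; apply: ub_le_sup => //; exists (a + (1 - a) * t).
      by rewrite /= in_itv/= ltr_wpDl ?mulr_gt0//=; nra.
    rewrite DESE; last by nra.
    rewrite max_l; last by nra.
    by rewrite addrAC subrr add0r mulrAC divff ?mul1r ?gt_eqF.
  apply/eqP; rewrite eq_le; apply/andP; split.
    apply: ge_sup => //; exists (DES a 2^-1), 2^-1 => //=.
    by rewrite in_itv/=; lra.
  rewrite leNgt; apply/negP => s1.
  have := S1 2^-1 ltac:(lra) ltac:(lra) => s2.
  by have := S1 ((sup S + 1) / 2) ltac:(lra) ltac:(lra); lra.
Unshelve. all: by end_near. Qed.

Lemma corresponds_QES (R : realType) (a : R) :
  a \in `[0, 1[ -> corresponds (DES a) (QES a).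
Proof.
rewrite in_itv/= => /andP[a0 a1].
have a1' : 0 < 1 - a by rewrite subr_gt0.
have sub : `]a, 1[%classic `<=` `]0, 1[%classic.
  by apply: subset_itvr; rewrite bnd_simp.
split=> [||u]; rewrite /QES /= /mscale /= /mrestr /= ?gtr0_norm//.
- by rewrite (_ : _ `&` _ = set0) ?measure0 ?mule0// -subset0 => x [+ /sub].
- rewrite setIidr// lebesgue_measure_itv/= lte_fin a1 -EFinB -EFinM.
  by rewrite mulVf// gt_eqF.
- rewrite in_itv/= => /andP[u0 u1].
  rewrite (_ : _ `&` _ = `]a, u]%classic); last first.
    apply/seteqP; split=> x /=; rewrite !in_itv/=.
      by move=> [/andP[x0 xu] /andP[ax x1]]; rewrite ax.
    move=> /andP[ax xu]; rewrite xu ax (le_lt_trans a0 ax)/=.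
    by rewrite (le_lt_trans xu).
  rewrite /DES indicE lebesgue_measure_itv/= lte_fin mem_setE in_itv/= (ltW u1).
  rewrite andbT le_eqVlt; case: ltP => [au|ua].
    by rewrite orbT mulr1 -EFinB -EFinM mulrC.
  by rewrite orbF mule0; case: eqP => [->|_]; rewrite ?subrr ?mul0r ?mulr0.
Qed.

(* Main.v *)
From HB Require Import structures.
From mathcomp Require Import measurable_realfun lra.
Require Import Defs.

(** Under [Q], the quantile function of [X] is a random variable whose
    distribution function is [D] composed with that of [X], because
    [quantile X u <= x] iff [u <= cdf X x].  Hence a smaller distortion function
    gives a stochastically larger variable, and the tail formula for expectations
    turns this pointwise order of distribution functions into the order of the
    integrals; for [D = DE] it identifies the risk measure with the expectation.
    A convex distortion lies below its chord [DE].  Finally, as [a] decreases to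
    0 the integrals over (a, 1) of the positive and of the negative part of the
    quantile function converge monotonically to those over (0, 1), so the expected
    shortfalls converge to the expectation. *)

Local Open Scope classical_set_scope.
Local Open Scope ring_scope.

(** * Stochastic order and expectations *)

Section stochastic_dominance.
Local Open Scope ereal_scope.
Context (R : realType) d1 d2 (T1 : measurableType d1) (T2 : measurableType d2)
  (P1 : probability T1 R) (P2 : probability T2 R)
  (X : {RV P1 >-> R}) (Y : {RV P2 >-> R}).
Hypothesis XY : forall r, cdf Y r <= cdf X r.

(** By the tail formula, the expectation of a nonnegative variable is the integral of its [ccdf]
    over the nonnegative half-line. There a positive part has the same [ccdf] as the variable
    itself, namely 1 - [cdf]. *)
Lemma le_expectation_funrpos : 'E_P1[X^\+%R] <= 'E_P2[Y^\+%R].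
Proof.
rewrite !ge0_expectation_ccdf; do ?by move=> x; exact: funrpos_ge0.
apply: ge0_le_integral => //=.
- by apply: measurable_funTS; exact: ccdf_measurable.
- by apply: measurable_funTS; exact: ccdf_measurable.
- move=> r; rewrite in_itv/= andbT => r0.
  have ccdf_pos d (T : measurableType d) (P : probability T R)
      (Z : {RV P >-> R}) : ccdf (Z^\+%R : {RV P >-> R}) r = ccdf Z r.
    congr (P _); apply/seteqP; split => t /=;
      by rewrite !in_itv/= !andbT lt_max (ltNge r 0%R) r0 orbF.
  by rewrite !ccdf_pos !ccdf_1_cdf leeB.
Qed.

Lemma le_expectation_funrneg : 'E_P2[Y^\-%R] <= 'E_P1[X^\-%R].
Proof.
have EN d (T : measurableType d) (P : probability T R) (Z : {RV P >-> R}) :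
    'E_P[Z^\-%R] =
    \int[lebesgue_measure]_(r in `]-oo, 0%R[) cdf Z r.
  apply: oppe_inj.
  transitivity ('E_P[(- Z^\-)%R : {RV P >-> R}]).
    rewrite !expectation_def -integral_ge0N//.
    by move=> x _; rewrite lee_fin funrneg_ge0.
  rewrite le0_expectation_cdf; last by move=> x; rewrite oppr_le0 funrneg_ge0.
  (* For [r < 0], the variable minus its negative part is at most [r] exactly when [Z] is. *)
  congr (- _); apply: eq_integral => r /[!inE]/=; rewrite in_itv/= => r0.
  congr (P _); apply/seteqP; split => t /=;
    by rewrite !in_itv/= lerNl le_max lerN2 (leNgt _ 0%R) oppr_gt0 r0 orbF.
rewrite !EN; apply: ge0_le_integral => //=.
- by apply: measurable_funTS; exact: cdf_measurable.
- by apply: measurable_funTS; exact: cdf_measurable.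
Qed.

(* No integrability is assumed: [+oo - +oo = -oo] makes the difference of the two
   parts monotone in all cases. *)
Lemma le_expectation_cdf : 'E_P1[X] <= 'E_P2[Y].
Proof.
have E d (T : measurableType d) (P : probability T R) (Z : {RV P >-> R}) :
    'E_P[Z] = 'E_P[Z^\+%R] - 'E_P[Z^\-%R].
  rewrite !expectation_def integralE; congr (_ - _).
    by rewrite -[fun x => (Z x)%:E]/(EFin \o Z) funerpos.
  by rewrite -[fun x => (Z x)%:E]/(EFin \o Z) funerneg.
rewrite (E _ _ P1) (E _ _ P2).
by apply: leeB; [exact: le_expectation_funrpos|exact: le_expectation_funrneg].
Qed.

End stochastic_dominance.

(** * The quantile function as generalized inverse of the [cdf] *)

Section quantile_theory.
Context (R : realType) d (T : measurableType d) (P : probability T R)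
  (X : {RV P >-> R}).

(** The bounds on [u] make the infimum genuine: [u < 1] gives a nonempty set, [0 < u] a lower bound.
    Right-continuity of the [cdf] then puts the infimum in the set. *)
Lemma quantile_le (u x : R) : u \in `]0, 1[ ->
  (quantile X u <= x) = (u%:E <= cdf X x)%E.
Proof.
rewrite in_itv/= => /andP[u0 u1].
rewrite /quantile; set S := [set y : R | (u%:E <= cdf X y)%E].
have S0 : S !=set0.
  apply: contrapT => /set0P/negP/negPn/eqP S0.
  have : (1%E <= u%:E)%E.
    rewrite -(cvg_lim _ (@cvg_cdfy1 _ _ _ _ X))//; apply: lime_le.
      by apply/cvg_ex; eexists; exact: cvg_cdfy1.
    near=> y; rewrite leNgt; apply/negP => /ltW uy.
    by have : S y by []; rewrite S0.
  by rewrite lee_fin leNgt u1.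
(* Near -oo the [cdf] is below [u]; by monotonicity any such point is a lower bound. *)
have SX : has_lbound S.
  apply: contrapT => SX.
  have : (u%:E <= 0)%E.
    rewrite -(cvg_lim _ (@cvg_cdfNy0 _ _ _ _ X))//; apply: lime_ge.
      by apply/cvg_ex; eexists; exact: cvg_cdfNy0.
    near=> y; rewrite leNgt; apply/negP => yu.
    apply: SX; exists y => z Sz; rewrite leNgt; apply/negP => zy.
    move: yu; rewrite ltNge => /negP; apply; apply: (le_trans Sz).
    by apply: cdf_nondecreasing; exact: ltW.
  by rewrite lee_fin leNgt u0.
apply/idP/idP => [ix|ux]; last exact: ge_inf.
apply: (@le_trans _ _ (cdf X (inf S))); last exact: cdf_nondecreasing.
have := @cdf_right_continuous _ _ _ _ X (inf S) => Fc.
rewrite -(cvg_lim _ Fc)//; apply: lime_ge; first by apply/cvg_ex; eexists; exact: Fc.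
near=> y.
have [z Sz zy] : exists2 z, S z & z < y.
  have Sy : inf S < y by (near: y; exact: nbhs_right_gt).
  by have [z Sz zy] := inf_lt S0 Sy; exists z.
by apply: (le_trans Sz); apply: cdf_nondecreasing; exact: ltW.
Unshelve. all: by end_near. Qed.

Lemma measurable_quantile :
  measurable_fun (`]0, 1[%classic : set (measurableTypeR R)) (quantile X).
Proof.
apply: (measurability _ (RGenOInfty.measurableE R)) => _ [_ [x ->] <-].
rewrite (_ : _ `&` _ = `]0, 1[ `&` `]fine (cdf X x), +oo[)%classic.
  exact: measurableI.
have E u : u \in `]0, 1[ -> (x < quantile X u) = (fine (cdf X x) < u).
  move=> u01; rewrite !ltNge quantile_le//.
  by rewrite -[cdf X x]fineK ?fin_num_measure.
by apply/seteqP; split => u [] /= u01; rewrite !in_itv/= !andbT E//; split.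
Qed.

End quantile_theory.

(** * Endpoint value and convexity of distortion functions *)

Section distortion_theory.
Context (R : realType) (D : R -> R) (hD : distortion D).

Lemma distortion_le1 u : u \in `[0, 1] -> D u <= 1.
Proof. by move=> /(distortion_itv hD); rewrite in_itv/= => /andP[]. Qed.

Lemma distortion1 : D 1 = 1.
Proof.
apply/eqP; rewrite eq_le distortion_le1 ?in_itv/= ?ler01 ?lexx//=.
rewrite -[leLHS](distortion_sup hD); apply: ge_sup.
  by exists (D 2^-1), 2^-1 => //=; rewrite in_itv/=; lra.
apply/ubP => _ [u + <-]; rewrite /= in_itv/= => /andP[u0 u1].
by apply: (distortion_nd hD); rewrite ?in_itv/=; lra.
Qed.

Lemma convex_distortion_le_DE :
  @convex_function R R^o `[0, 1]%classic D -> le01 D (@DE R).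
Proof.
move=> cD u; rewrite in_itv/= => /andP[u0 u1].
have := cD (Itv01 u0 u1) 1 0.
rewrite !inE/= !in_itv/= !lexx ler01 => /(_ isT isT).
rewrite !convRE/= distortion1 (distortion0 hD) !mulr0 !addr0 !mulr1.
have cE : conv (Itv01 u0 u1) (1 : R^o) 0 = u by rewrite convRE mulr1 mulr0 addr0.
by rewrite -[X in _ -> D X <= _]cE.
Qed.

End distortion_theory.

(** * The quantile function as a random variable under [Q] *)

Section quantile_random_variable.
Context (R : realType) d (T : measurableType d) (P : probability T R)
  (X : {RV P >-> R}).

(* The truncation is needed: outside (0, 1) the infimum defining [quantile X] may be
   that of an empty or unbounded set, hence 0, and monotonicity fails. *)
Definition quantile01 : measurableTypeR R -> R := quantile X \_ `]0, 1[.

Let measurable_quantile01 : measurable_fun [set: measurableTypeR R] quantile01.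
Proof.
have m01 : measurable (`]0, 1[%classic : set (measurableTypeR R)).
  exact: measurable_itv.
apply/(measurable_restrictT _ m01); exact: measurable_quantile.
Qed.

HB.instance Definition _ :=
  isMeasurableFun.Build _ _ _ _ quantile01 measurable_quantile01.

(** This turns statements about [qdom] and [qrm] into statements about expectations. Within (0, 1),
    the event that the quantile is at most [x] is the set of [u] with [u <= cdf X x], whose measure
    [D] prescribes. *)
Lemma corresponds_quantile_rv (D : R -> R)
    (Q : {measure set (measurableTypeR R) -> \bar R}) :
  distortion D -> corresponds D Q ->
  exists (Q' : probability (measurableTypeR R) R) (Y : {RV Q' >-> R}),
    [/\ forall x, cdf Y x = (D (fine (cdf X x)))%:E,
      (\int[Q]_(u in `]0%R, 1%R[) (Num.max (quantile X u) 0)%:E)%E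
        = 'E_Q'[Y^\+%R]%E
    & qrm Q X = 'E_Q'[Y]%E].
Proof.
move=> hD [Qout Q01 Qval].
have QT : Q setT = 1%E.
  rewrite -(setUv (`]0, 1[%classic : set (measurableTypeR R))) measureU//.
  - transitivity (1 + 0 : \bar R)%E; last by rewrite adde0.
    by congr (_ + _)%E.
  - exact: measurableC.
  - by rewrite setICr.
(* [Q] has mass 1, so normalizing only repackages it as a probability. *)
pose Q' : probability (measurableTypeR R) R :=
  mnormalize Q (dirac (point : measurableTypeR R)).
have Q'E A : Q' A = Q A by rewrite /Q'/= /mnormalize/= QT onee_eq0/= invr1 mule1.
exists Q', quantile01; split.
- move=> x.
  set c := fine (cdf X x).
  have cE : cdf X x = c%:E by rewrite fineK// fin_num_measure.
  have c0 : 0 <= c by rewrite fine_ge0.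
  have c1 : c <= 1 by rewrite -lee_fin -cE cdf_le1.
  have mA : measurable (quantile01 @^-1` `]-oo, x]).
    exact: measurable_funPTI.
  have mI : measurable (`]0, 1[%classic : set (measurableTypeR R)).
    exact: measurable_itv.
  transitivity (Q (quantile01 @^-1` `]-oo, x] `&` `]0, 1[%classic)).
    rewrite /cdf /distribution /pushforward Q'E.
    rewrite -[RHS]add0e (measureDI Q mA mI); congr (_ + _)%E.
    apply: (@subset_measure0 _ _ _ Q _ (~` `]0, 1[%classic)) => //.
      exact: measurableD.
    exact: measurableC.
  (* The correspondence gives the mass of (0, c] only for [c] strictly between 0 and 1, so both
     endpoints are treated apart. *)
  have [c00|c0'] := eqVneq c 0.
    rewrite c00 (distortion0 hD) (_ : _ `&` _ = set0) ?measure0//.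
    rewrite -subset0 => u [] /= /[swap] u01.
    rewrite in_itv/= /quantile01 patchE mem_setE u01 quantile_le// cE lee_fin.
    by rewrite c00 leNgt; move: u01; rewrite in_itv/= => /andP[->].
  have [c11|c1'] := eqVneq c 1.
    rewrite c11 distortion1// (_ : _ `&` _ = `]0, 1[%classic)//.
    apply/setIidPr => u /= u01.
    rewrite in_itv/= /quantile01 patchE mem_setE u01 quantile_le// cE lee_fin.
    by rewrite c11 ltW//; move: u01; rewrite in_itv/= => /andP[].
  rewrite -Qval; last by rewrite in_itv/= !lt_neqAle c1' c1 eq_sym c0' c0.
  congr (Q _); apply/seteqP; split => [u [] /= /[swap] u01|u /=].
    rewrite in_itv/= /quantile01 patchE mem_setE u01 quantile_le// cE lee_fin.
    by move: u01; rewrite !in_itv/= => /andP[-> _].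
  rewrite in_itv/= => /andP[u0 uc].
  have u01 : u \in `]0, 1[.
    by rewrite in_itv/= u0 (le_lt_trans uc)// lt_neqAle c1' c1.
  split=> //=.
  by rewrite in_itv/= /quantile01 patchE mem_setE u01 quantile_le// cE lee_fin.
- rewrite expectation_def integral_mkcond.
  transitivity (\int[Q']_u ((fun u => (Num.max (quantile X u) 0)%:E) \_ `]0%R, 1%R[) u)%E.
    by apply: eq_measure_integral => A _ _; rewrite -Q'E.
  apply: eq_integral => u _ /=; rewrite /funrpos /quantile01 !patchE.
  by case: ifP => // _; rewrite maxxx.
- rewrite /qrm expectation_def integral_mkcond.
  transitivity (\int[Q']_u ((fun u => (quantile X u)%:E) \_ `]0%R, 1%R[) u)%E.
    by apply: eq_measure_integral => A _ _; rewrite -Q'E.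
  apply: eq_integral => u _ /=; rewrite /quantile01 !patchE.
  by case: ifP.
Qed.

End quantile_random_variable.

(** * Order of distortions and order of risk measures *)

Section comparison.
Context (R : realType) d (T : measurableType d) (P : probability T R).
Local Notation measureR := {measure set (measurableTypeR R) -> \bar R}.

Lemma le01_quantile_risk (D1 D2 : R -> R) (Q1 Q2 : measureR) :
  distortion D1 -> distortion D2 -> corresponds D1 Q1 -> corresponds D2 Q2 ->
  le01 D1 D2 ->
  qdom P Q1 `<=` qdom P Q2 /\ forall X, (qrm (P := P) Q2 X <= qrm Q1 X)%E.
Proof.
move=> hD1 hD2 hQ1 hQ2 D12.
have cdf01 (X : {RV P >-> R}) x : fine (cdf X x) \in `[0, 1].
  by rewrite in_itv/= fine_ge0//= -lee_fin fineK ?cdf_le1// fin_num_measure.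
split=> X.
  rewrite /qdom /=.
  have [Q1' [Y1 [F1 -> _]]] := corresponds_quantile_rv X hD1 hQ1.
  have [Q2' [Y2 [F2 -> _]]] := corresponds_quantile_rv X hD2 hQ2.
  apply: le_lt_trans; apply: le_expectation_funrpos => r.
  by rewrite F1 F2 lee_fin D12.
have [Q1' [Y1 [F1 _ ->]]] := corresponds_quantile_rv X hD1 hQ1.
have [Q2' [Y2 [F2 _ ->]]] := corresponds_quantile_rv X hD2 hQ2.
by apply: le_expectation_cdf => r; rewrite F1 F2 lee_fin D12.
Qed.

(** For the identity distortion the quantile variable has the same [cdf] as [X], and dominance
    applies in both directions. *)
Lemma expectation_qrm_QE (X : {RV P >-> R}) : 'E_P[X]%E = qrm (QE R) X.
Proof.
have [Q [Y [F _ ->]]] :=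
  corresponds_quantile_rv X (distortion_DE R) (corresponds_QE R).
have FE r : cdf Y r = cdf X r by rewrite F /DE fineK// fin_num_measure.
by apply/eqP; rewrite eq_le !le_expectation_cdf// => r; rewrite FE.
Qed.

Lemma le01_DES (a b : R) : 0 <= a -> b < 1 -> a <= b -> le01 (DES b) (DES a).
Proof.
move=> a0 b1 ab u; rewrite in_itv/= => /andP[u0 u1].
rewrite /DES !indicE !mem_setE !in_itv/= u1 !andbT.
have [bu|ub] := leP b u.
  rewrite (le_trans ab bu) !mulr1 ler_pdivrMr ?subr_gt0//.
  (* After clearing denominators the claim is (b - a)(u - 1) <= 0. *)
  by rewrite mulrAC ler_pdivlMr ?subr_gt0 ?(le_lt_trans ab)//; nra.
rewrite mulr0; have [au|_] := leP a u; last by rewrite mulr0.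
by rewrite mulr1 divr_ge0// subr_ge0// (le_trans ab)// ltW.
Qed.

Lemma le01_DES_DE (a : R) : 0 <= a -> a < 1 -> le01 (DES a) (@DE R).
Proof.
move=> a0 a1 u; rewrite in_itv/= => /andP[u0 u1].
rewrite /DES /DE indicE mem_setE in_itv/= u1 andbT.
have [au|_] := leP a u; last by rewrite mulr0.
by rewrite mulr1 ler_pdivrMr ?subr_gt0//; nra.
Qed.

End comparison.

(** * Convergence of expected shortfalls as the level tends to 0 *)

Section expected_shortfall_limit.
Context (R : realType).
Local Open Scope ereal_scope.

Lemma ge0_integral_mrestr d (T : measurableType d)
    (mu : {measure set T -> \bar R}) (D E : set T) (mD : measurable D)
    (f : T -> \bar R) :
  measurable E -> D `<=` E -> measurable_fun E f ->
  (forall x, E x -> 0 <= f x) ->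
  \int[mrestr mu mD]_(x in E) f x = \int[mu]_(x in D) f x.
Proof.
move=> mE DE mf f0.
rewrite (@ge0_negligible_integral _ _ _ _ E (~` D) f (measurableC mD))//; last first.
  by rewrite /= /mrestr setICl measure0.
rewrite setDE setCK setIidr//; apply: eq_measure_integral => A mA AD.
by rewrite /= /mrestr setIidl.
Qed.

Lemma cvg_integral_QES (f : R -> \bar R) :
  measurable_fun (`]0%R, 1%R[%classic : set (measurableTypeR R)) f ->
  (forall x, x \in `]0%R, 1%R[ -> 0 <= f x) ->
  \int[QES (n.+2%:R^-1)%R]_(x in `]0%R, 1%R[) f x @[n --> \oo] -->
  \int[QE R]_(x in `]0%R, 1%R[) f x.
Proof.
move=> mf f0.
have m01 : measurable (`]0%R, 1%R[%classic : set (measurableTypeR R)).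
  exact: measurable_itv.
(* The shift by 2 keeps every level strictly inside (0, 1), already at [n = 0]. *)
pose a n : R := (n.+2%:R^-1)%R.
have a0 n : (0 < a n)%R by rewrite invr_gt0.
have sub n : `]a n, 1%R[%classic `<=` `]0%R, 1%R[%classic.
  by apply: subset_itvr; rewrite bnd_simp ltW.
have a_cvg : a n @[n --> \oo] --> (0:R)%R.
  by rewrite /a (cvg_shiftS (@harmonic R)); exact: cvg_harmonic.
rewrite [X in _ --> X]ge0_integral_mrestr// -[X in _ --> X]mul1e.
under eq_fun => n.
  rewrite ge0_integral_mscale// ge0_integral_mrestr//; last exact: sub.
  over.
(* The density factor tends to 1, and the integrals over the growing intervals (a n, 1) converge
   monotonically. *)
apply: cvgeM.
- by rewrite mule_defE onee_eq0/= andbF.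
- apply: cvg_EFin; first exact: nearW.
  have : (1 - a n)%R @[n --> \oo] --> (1 - 0 : R)%R.
    by apply: (@cvgB _ R^o); [exact: cvg_cst|exact: a_cvg].
  rewrite subr0 => /cvg_norm; rewrite normr1 => /(cvgV (oner_neq0 R)).
  by rewrite invr1.
- rewrite [in X in _ --> X](_ : `]0%R, 1%R[%classic = \bigcup_n `]a n, 1%R[%classic).
    apply: ge0_nondecreasing_set_cvg_integral => //.
    + move=> m n mn; apply/subsetPset/subset_itvr.
      by rewrite bnd_simp lef_pV2 ?posrE// ler_nat.
    + by move=> n; apply: measurable_funS mf => //; exact: sub.
    + by move=> n x /sub; exact: f0.
  apply/seteqP; split => [x /=|x [n _] /sub//].
  rewrite in_itv/= => /andP[x0 x1].
  have [n _ nx] : \forall n \near \oo, (a n < x)%R.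
    by apply: (cvgr_lt _ a_cvg).
  by exists n => //=; rewrite in_itv/= x1 andbT; apply: nx => /=.
Qed.

Lemma cvg_qrm_QES d (T : measurableType d) (P : probability T R)
    (X : {RV P >-> R}) :
  qdom P (QE R) X ->
  qrm (QES (n.+2%:R^-1)%R) X @[n --> \oo] --> qrm (QE R) X.
Proof.
move=> XQ; rewrite /qrm [X in _ --> X]integralE.
have mq : measurable_fun (`]0%R, 1%R[%classic : set (measurableTypeR R))
    (EFin \o quantile X).
  by apply/measurable_EFinP; exact: measurable_quantile.
under eq_fun do rewrite integralE.
apply: cvgeB.
(* Membership in [qdom] makes the positive part's integral finite, so the difference of limits is
   defined even if the negative part's is infinite. *)
- apply: fin_num_adde_defr.
  rewrite ge0_fin_numE; last exact: integral_ge0.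
  apply: le_lt_trans XQ; rewrite le_eqVlt; apply/predU1l/eq_integral => u _.
  by rewrite funeposE EFin_max.
- apply: cvg_integral_QES; [exact: measurable_funepos|by move=> x _; exact: funepos_ge0].
- apply: cvg_integral_QES; [exact: measurable_funeneg|by move=> x _; exact: funeneg_ge0].
Qed.

End expected_shortfall_limit.

Theorem corollary3p8 (R : realType) (d : measure_display) (T : measurableType d)
    (P : probability T R) (D D1 D2 : R -> R)
    (Q Q1 Q2 : probability (measurableTypeR R) R)
    (hD : distortion D) (hD1 : distortion D1) (hD2 : distortion D2)
    (hQ : corresponds D Q) (hQ1 : corresponds D1 Q1) (hQ2 : corresponds D2 Q2) :
  (le01 D1 D2 ->
     qdom P Q1 `<=` qdom P Q2 /\
     forall X, qdom P Q1 X -> (qrm Q2 X <= qrm Q1 X)%E) /\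
  (le01 D (@DE R) ->
     qdom P Q `<=` qdom P (QE R) /\
     forall X, qdom P Q X -> ('E_P[X] <= qrm Q X)%E) /\
  (@convex_function R R^o `[0, 1]%classic D ->
     qdom P Q `<=` qdom P (QE R) /\
     forall X, qdom P Q X -> ('E_P[X] <= qrm Q X)%E) /\
  (forall a b : R, a \in `[0, 1[ -> b \in `[0, 1[ -> a <= b ->
     forall X, qdom P (QE R) X -> (qrm (QES a) X <= qrm (QES b) X)%E) /\
  (forall X, qdom P (QE R) X ->
     ('E_P[X] = ereal_inf [set qrm (QES a) X | a in `]0%R, 1%R[])%E).
Proof.
have le_DE : le01 D (@DE R) ->
    qdom P Q `<=` qdom P (QE R) /\
    forall X, qdom P Q X -> ('E_P[X] <= qrm Q X)%E.
  move=> DDE.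
  have [sub le] := le01_quantile_risk P hD (distortion_DE R) hQ
    (corresponds_QE R) DDE.
  by split=> // X _; rewrite expectation_qrm_QE.
split; first by move=> /(le01_quantile_risk P hD1 hD2 hQ1 hQ2)[].
split; first exact: le_DE.
split; first by move=> /(convex_distortion_le_DE hD)/le_DE.
split.
  move=> a b a01 b01 ab X _.
  apply: (le01_quantile_risk P (distortion_DES b01) (distortion_DES a01)
    (corresponds_QES b01) (corresponds_QES a01) _).2.
  by move: a01 b01; rewrite !in_itv/= => /andP[a0 _] /andP[_ b1]; exact: le01_DES.
move=> X XQ; rewrite expectation_qrm_QE; apply/eqP; rewrite eq_le; apply/andP; split.
  apply: le_ereal_inf_tmp => _ [a + <-]; rewrite /= in_itv/= => /andP[a0 a1].
  have a01 : a \in `[0, 1[ by rewrite in_itv/= a1 ltW.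
  apply: (le01_quantile_risk P (distortion_DES a01) (distortion_DE R)
    (corresponds_QES a01) (corresponds_QE R) _).2.
  by apply: le01_DES_DE => //; exact: ltW.
(* The expectation is a limit of shortfalls at levels in (0, 1), each at least the infimum. *)
rewrite -(cvg_lim _ (cvg_qrm_QES XQ))//; apply: lime_ge.
  by apply/cvg_ex; eexists; exact: cvg_qrm_QES.
apply: nearW => n; apply: ereal_inf_lbound; exists n.+2%:R^-1 => //=.
by rewrite in_itv/= invr_gt0 ltr0n invf_lt1 ?ltr1n.
Qed.
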